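(* Let $\mathscr X=G/K$ be the homogeneous space of a compact group $G$ ($K$ a closed subgroup), let $V\subset L^2(\mathscr X)$ be a self-conjugated irreducible $G$-module and let $(v_k)_{-\ell\le k\le\ell}$ be a self-conjugated orthonormal basis of $V$ (with $k\ne0$ if $\dim V$ is even). Let $T$ be a real a.s. square integrable random field on $\mathscr X$ and let $a_k=\int_{\mathscr X}T(x)\overline{v_k(x)}\,dx$, $-\ell\le k\le\ell$, be its random coefficients with respect to this basis. Suppose that the real and imaginary parts of the random variables $a_k$, $k\ge0$ (resp. $k>0$ if $\dim V$ is even) are centered, independent and Gaussian, and that there exists $c\ge0$ such that $\mathrm E[(\operatorname{Re}a_k)^2]=\mathrm E[(\operatorname{Im}a_k)^2]=\frac c2$ for $k\neq0$ and $\mathrm E[a_0^2]=c$ (the latter only if $\dim V$ is odd). Then the random field $$T_V=\sum_{k=-\ell}^{\ell}a_kv_k$$ is $G$-invariant.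
   Context: $dx$ is the normalized $G$-invariant measure on $\mathscr X$, and $L^2(\mathscr X)$ is the space of complex-valued square integrable functions, on which $G$ acts by $L_gf(x)=f(g^{-1}x)$. An irreducible $G$-module $V\subset L^2(\mathscr X)$ (which consists of continuous functions) is self-conjugated if $\overline V=V$. A self-conjugated orthonormal basis of $V$ is an orthonormal basis $(v_k)_{-\ell\le k\le\ell}$ with $v_{-k}=\overline{v_k}$ for every $k$; if $\dim V=2\ell+1$ is odd then $v_0$ is a real function, and if $\dim V=2\ell$ is even the index $k=0$ is omitted. Since $T$ is real, $a_{-k}=\overline{a_k}$ and $a_0$ is real. A random field is a family $(T(x))_{x\in\mathscr X}$ of random variables on a probability space such that $(x,\omega)\mapsto T(x,\omega)$ is jointly measurable; it is a.s. square integrable if $\int|T(x)|^2dx<\infty$ a.s. A random field $S$ is $G$-invariant if for every $g\in G$ and $x_1,\dots,x_m\in\mathscr X$ the vectors $(S(x_1),\dots,S(x_m))$ and $(S(gx_1),\dots,S(gx_m))$ have the same law. Gaussian laws may be degenerate. *)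

(* Defs.v *)
From HB Require Import structures.
From mathcomp Require Import all_boot all_order all_algebra.
From mathcomp Require Import all_classical all_reals all_analysis.
From mathcomp Require Import generic_quotient.
From mathcomp.real_closed Require Import complex.
Set Implicit Arguments.
Unset Strict Implicit.
Unset Printing Implicit Defensive.
Import Order.TTheory GRing.Theory Num.Theory.
Import numFieldNormedType.Exports.
Local Open Scope classical_set_scope.
Local Open Scope ring_scope.
Local Open Scope complex_scope.
Local Open Scope quotient_scope.

HB.mixin Record isTopologicalGroup G & Group G & Topological G := {
  mulg_continuous : continuous (fun p : G * G => (p.1 * p.2)%g);
  invg_continuous : continuous (fun x : G => x^-1%g)
}.

#[short(type="topologicalGroupType")]
HB.structure Definition TopologicalGroup :=
  {G of Group G & Topological G & isTopologicalGroup G}.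

Record closedSubgroup (G : topologicalGroupType) := ClosedSubgroup {
  csubg_set : set G;
  csubg_closed : closed csubg_set;
  csubg1 : csubg_set 1%g;
  csubgM : forall x y, csubg_set x -> csubg_set y -> csubg_set (x * y)%g;
  csubgV : forall x, csubg_set x -> csubg_set x^-1%g
}.

Section coset_space.
Variables (G : topologicalGroupType) (K : closedSubgroup G).

Definition coset_rel : rel G := fun x y => `[< csubg_set K (x^-1 * y)%g >].

Lemma coset_rel_refl : reflexive coset_rel.
Proof. by move=> x; apply/asboolP; rewrite mulVg; exact: csubg1. Qed.

Lemma coset_rel_sym : symmetric coset_rel.
Proof.
have H x y : csubg_set K (x^-1 * y)%g -> csubg_set K (y^-1 * x)%g.
  by move=> /csubgV; rewrite invgM invgK.
by move=> x y; apply/asboolP/asboolP; exact: H.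
Qed.

Lemma coset_rel_trans : transitive coset_rel.
Proof.
move=> y x z /asboolP xy /asboolP yz; apply/asboolP.
by have := csubgM xy yz; rewrite -mulgA (mulgA y) mulgV mul1g.
Qed.

Canonical coset_equiv :=
  EquivRel coset_rel coset_rel_refl coset_rel_sym coset_rel_trans.

(* G/K with the quotient topology and its Borel sigma-algebra; the base point
   is the coset K. *)
Definition coset_space : Type := quotient_topology {eq_quot coset_rel}.

HB.instance Definition _ :=
  Topological.copy coset_space (quotient_topology {eq_quot coset_rel}).
HB.instance Definition _ :=
  Quotient.copy coset_space (quotient_topology {eq_quot coset_rel}).
HB.instance Definition _ :=
  isPointed.Build coset_space (\pi_coset_space 1%g).
HB.instance Definition _ := Measurable.copy coset_space
  (g_sigma_algebraType (@open coset_space)).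

Definition coset_act (g : G) (x : coset_space) : coset_space :=
  (\pi_coset_space (g * repr x)%g).

Lemma coset_act_pi (g h : G) :
  coset_act g (\pi_coset_space h) = (\pi_coset_space (g * h)%g).
Proof.
apply/eqmodP => /=; apply/asboolP.
have /eqmodP/= /asboolP := reprK ((\pi_coset_space h) : coset_space).
by rewrite invgM -mulgA (mulgA g^-1%g) mulVg mul1g.
Qed.

End coset_space.

Section complex_functions.
Variable R : realType.

(* The Borel sigma-algebra of C = R^2. *)
HB.instance Definition _ := Pointed.copy R[i] R[i]^o.
HB.instance Definition _ := Measurable.copy R[i]
  (g_sigma_algebra_preimageType
    (fun z : R[i] => (complex.Re z, complex.Im z) : R * R)).

Context d (X : measurableType d) (mu : {measure set X -> \bar R}).

Definition Cintegral (f : X -> R[i]) : R[i] :=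
  (\int[mu]_x complex.Re (f x)) +i* (\int[mu]_x complex.Im (f x)).

Definition Cdot (f h : X -> R[i]) : R[i] :=
  Cintegral (fun x => f x * (h x)^*).

Definition CL2 : set (X -> R[i]) := [set f | measurable_fun setT f /\
  (\int[mu]_x (Normc.normc (f x) ^+ 2)%:E < +oo)%E].

End complex_functions.

Section harmonic.
Variables (R : realType) (G : topologicalGroupType) (K : closedSubgroup G).
Let X := coset_space K.

(* On a compact homogeneous space, G-invariance and regularity determine the
   Borel probability measure uniquely; for finite Borel measures on a compact
   Hausdorff space, outer regularity implies inner regularity. *)
Definition normalized_invariant_measure (mu : probability X R) : Prop :=
  (forall (g : G) (A : set X), measurable A ->
     mu (coset_act g @^-1` A) = mu A) /\
  (forall A : set X, measurable A ->
     mu A = ereal_inf [set mu U | U in [set U : set X | open U /\ A `<=` U]]).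

Definition left_translate (g : G) (f : X -> R[i]) : X -> R[i] :=
  fun x => f (coset_act g^-1%g x).

Definition is_Gsubmodule (V : set (X -> R[i])) : Prop :=
  [/\ V (fun=> 0),
      forall (c : R[i]) f h, V f -> V h -> V (fun x => c * f x + h x) &
      forall g f, V f -> V (left_translate g f)].

(* Elements of L^2 are represented by their (unique) continuous versions. An
   irreducible module of a compact group is finite-dimensional, so that its
   submodules are automatically closed. *)
Definition irreducible_Gmodule (mu : probability X R) (V : set (X -> R[i])) :
    Prop :=
  [/\ V `<=` CL2 mu,
      (forall f, V f -> continuous (f : X -> R[i]^o)),
      is_Gsubmodule V,
      V <> [set (fun=> 0)] &
      forall W : set (X -> R[i]), W `<=` V -> is_Gsubmodule W ->
        W = [set (fun=> 0)] \/ W = V].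

Definition self_conjugated (V : set (X -> R[i])) : Prop :=
  [set (fun x => (f x)^*) | f in V] = V.

(* -l, ..., l, without 0 when the dimension is even. *)
Definition sc_indices (l : nat) (odd_dim : bool) : seq int :=
  [seq k <- [seq (i%:Z - l%:Z)%R | i <- iota 0 l.*2.+1] | odd_dim || (k != 0)].

Definition self_conjugated_orthonormal_basis (mu : probability X R)
    (V : set (X -> R[i])) (l : nat) (odd_dim : bool) (v : int -> X -> R[i]) :
    Prop :=
  [/\ {in sc_indices l odd_dim, forall k, V (v k)},
      {in sc_indices l odd_dim &, forall j k,
        Cdot mu (v j) (v k) = (j == k)%:R},
      (forall f, V f -> exists c : int -> R[i],
         forall x, f x = \sum_(k <- sc_indices l odd_dim) c k * v k x) &
      {in sc_indices l odd_dim, forall k x, v (- k) x = (v k x)^*}].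

End harmonic.

Section random_fields.
Context (R : realType) dO (Omega : measurableType dO) (P : probability Omega R).

Definition random_field d dE (X : measurableType d) (E : measurableType dE)
    (S : X -> Omega -> E) : Prop :=
  measurable_fun [set: X * Omega] (fun p => S p.1 p.2).

Definition as_square_integrable d (X : measurableType d)
    (mu : {measure set X -> \bar R}) (T : X -> Omega -> R) : Prop :=
  {ae P, forall w, (\int[mu]_x (`|T x w| ^+ 2)%:E < +oo)%E}.

Definition same_law d (E : measurableType d) (Y Z : Omega -> E) : Prop :=
  forall A : set E, measurable A -> P (Y @^-1` A) = P (Z @^-1` A).

Definition G_invariant (G : topologicalGroupType) (K : closedSubgroup G)
    dE (E : measurableType dE) (S : coset_space K -> Omega -> E) : Prop :=
  forall (g : G) (m : nat) (x : m.-tuple (coset_space K)),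
    same_law (fun w => [tuple S (tnth x i) w | i < m])
             (fun w => [tuple S (coset_act g (tnth x i)) w | i < m]).

(* [normal_prob m 0] is not the Dirac mass at [m], so that degenerate laws are
   treated separately. *)
Definition gaussian (Y : Omega -> R) : Prop :=
  measurable_fun setT Y /\ exists m s : R, forall A : set R, measurable A ->
    P (Y @^-1` A) = if s == 0 then \d_m A else normal_prob m s A.

Definition centered (Y : Omega -> R) : Prop := ('E_P[Y] = 0)%E.

Definition mutually_independent (I : eqType) (D : seq I)
    (Y : I -> Omega -> R) : Prop :=
  forall J : seq I, uniq J -> {subset J <= D} ->
  forall A : I -> set R, (forall i, measurable (A i)) ->
    P (\big[setI/setT]_(i <- J) (Y i @^-1` A i)) =
    (\prod_(i <- J) P (Y i @^-1` A i))%E.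

Definition random_coef d (X : measurableType d)
    (mu : {measure set X -> \bar R}) (T : X -> Omega -> R)
    (v : int -> X -> R[i]) (k : int) (w : Omega) : R[i] :=
  Cintegral mu (fun x => (T x w)%:C * (v k x)^*).

(* [false] selects the real part and [true] the imaginary part. *)
Definition re_im (a : int -> Omega -> R[i]) (p : int * bool) : Omega -> R :=
  fun w => if p.2 then complex.Im (a p.1 w) else complex.Re (a p.1 w).

Definition nonneg_re_im_indices (l : nat) (odd_dim : bool) :
    seq (int * bool) :=
  [seq (k, b) | k <- [seq k <- sc_indices l odd_dim | 0 <= k],
                b <- [:: false; true]].

End random_fields.

(* Main.v *)
Require Import Defs.
From HB Require Import structures.
From mathcomp Require Import all_boot all_order all_algebra.
From mathcomp Require Import generic_quotient.
From mathcomp Require Import all_classical all_reals all_analysis.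
From mathcomp Require Import measurable_realfun normal_distribution.
From mathcomp.real_closed Require Import complex.
From mathcomp Require Import zify ring lra.
Set Implicit Arguments.
Unset Strict Implicit.
Unset Printing Implicit Defensive.
Import Order.TTheory GRing.Theory Num.Theory.
Import numFieldNormedType.Exports.
Local Open Scope classical_set_scope.
Local Open Scope ring_scope.
Local Open Scope complex_scope.

(** In a real orthonormal basis of [V] the coefficients of the field form a
    Gaussian vector whose covariance is a multiple of the identity.  Such a
    vector has the same law as its image under any orthogonal matrix, and
    translating the field by an element of [G] acts on the coefficients by an
    orthogonal matrix.

    Everything is made real first.  The functions [sqrt 2 * Re v_k] for
    [0 < k], [sqrt 2 * Im v_k] for [k < 0], and [v_0], form an orthonormal
    family [u] of real functions ([real_basis_orthonormal]); a real function of
    [V] is a real combination of them ([real_basis_expand]), and [T_V] is the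
    real field whose coefficients [xi] are [sqrt 2 * Re a_k] for [0 < k],
    [sqrt 2 * Im a_(- k)] for [k < 0], and [a_0] ([sum_real_coef]).  The factors [sqrt 2] are what turns the variances
    [c/2], [c/2] and [c] into the common variance [c], so that [xi] is a family
    of independent variables with one and the same centered normal law, possibly
    degenerate ([iid_coef]).  Since [V] is stable under translations and [mu]
    is invariant, [u_p (g x) = \sum_q O q p * u_q x] with a matrix [O] whose
    columns are orthonormal ([real_basis_translate]).  Hence
    [T_V (g x) = \sum_q (O xi)_q * u_q x], and it remains to see that [O xi] has
    the law of [xi].

    For that ([iid_orthogonal]), [O] is reduced to the identity by plane
    rotations of its rows and sign changes, so that only a rotation of two
    coordinates has to be treated ([iid_givens]); conditioning on the other
    coordinates leaves the invariance of the product of two centered normal laws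
    under rotations ([centered_normal_rotation]).  The density of the standard
    law of the plane is a function of [x ^+ 2 + y ^+ 2], and Lebesgue measure is
    invariant because a rotation is a product of three shears, each of which
    translates the lines of one direction ([leb2_rotation]). *)

(** * Image measures, densities and affine maps of the line *)

(** The law of [f] under [m]; the measurability of [f] is an argument, so that
    the measure structure can be inferred for an arbitrary function. *)
Definition image_measure d1 d2 (T1 : measurableType d1) (T2 : measurableType d2)
    (R : realType) (m : {measure set T1 -> \bar R}) (f : T1 -> T2)
    (mf : measurable_fun setT f) : {measure set T2 -> \bar R} :=
  measure_function_pushforward__canonical__measure_function_Measure m mf.

Lemma ge0_integral_image d1 d2 (T1 : measurableType d1)
    (T2 : measurableType d2) (R : realType) (m : {measure set T1 -> \bar R})
    (f : T1 -> T2) (mf : measurable_fun setT f) (D : set T2) (h : T2 -> \bar R) :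
  measurable D -> measurable_fun setT h -> (forall y, 0 <= h y)%E ->
  (\int[image_measure m mf]_(y in D) h y = \int[m]_(x in f @^-1` D) h (f x))%E.
Proof.
move=> mD mh h0; apply: (ge0_integral_pushforward mf) => //.
exact: measurable_funTS.
Qed.

Section lebesgue_affine.
Variable R : realType.
Local Notation leb := (@lebesgue_measure R).
Local Notation RR := (measurableTypeR R).

Lemma measurable_affine (m s : R) :
  measurable_fun setT (fun x : RR => m + s * x : RR).
Proof. by apply: measurable_funD => //; exact: measurable_funM. Qed.

(** By uniqueness of Lebesgue measure, it suffices to compare both sides on
    half-open intervals. *)
Lemma lebesgue_measure_affine (m s : R) (A : set RR) : 0 < s -> measurable A ->
  (s%:E * leb ((fun x : RR => m + s * x)%R @^-1` A))%E = leb A.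
Proof.
move=> s0 mA.
pose phi : RR -> RR := fun x => m + s * x.
pose nu := mscale (NngNum (ltW s0)) (image_measure leb (measurable_affine m s)).
suff H X : ocitv X -> leb X = nu X.
  by rewrite (lebesgue_measure_unique H mA).
move=> [[a b]] _ <-.
have -> : nu `]a, b]%classic = (s%:E * leb (phi @^-1` `]a, b]%classic))%E by [].
have -> : phi @^-1` `]a, b]%classic = `](a - m) / s, (b - m) / s]%classic.
  apply/seteqP; split => x; rewrite /phi /= !in_itv /=
    ltr_pdivrMr// ler_pdivlMr// mulrC => /andP[? ?]; apply/andP; split; lra.
rewrite !lebesgue_measure_itv /= !lte_fin ltr_pM2r ?invr_gt0// ltrD2r.
case: ifP => _; last by rewrite mule0.
by rewrite -!EFinD -EFinM; congr EFin; field; lra.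
Qed.

End lebesgue_affine.

Section normal_affine.
Variable R : realType.
Local Notation leb := (@lebesgue_measure R).
Local Notation RR := (measurableTypeR R).

(** All nondegenerate normal laws are images of the standard one: the change of
    variable [m + s * x] turns one density into the other, the factor [s] being
    absorbed by the normalization. *)
Lemma normal_prob_affine (m s : R) (A : set RR) : 0 < s -> measurable A ->
  normal_prob m s A = normal_prob 0 1 ((fun x : RR => m + s * x) @^-1` A).
Proof.
move=> s0 mA; have sN0 : s != 0 by rewrite gt_eqF.
have maff := @measurable_affine R m s.
rewrite /normal_prob.
rewrite (@eq_measure_integral _ _ _ _
  (mscale (NngNum (ltW s0)) (image_measure leb maff))); last first.
  by move=> B mB _ /=; rewrite -(lebesgue_measure_affine m s0 mB).
have mpdf (a b : R) (C : set RR) :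
    measurable_fun C (fun x : RR => (normal_pdf a b x)%:E).
  by apply/measurable_EFinP/measurable_funTS; exact: measurable_normal_pdf.
rewrite ge0_integral_mscale//; last first.
  by move=> x _; rewrite lee_fin normal_pdf_ge0.
rewrite ge0_integral_image//; last first.
  by move=> x; rewrite lee_fin normal_pdf_ge0.
have mpA : measurable ((fun x : RR => m + s * x) @^-1` A).
  by rewrite -[X in measurable X]setTI; exact: maff.
rewrite -ge0_integralZl//; last 2 first.
- by apply: measurable_funTS; exact: measurableT_comp (mpdf m s setT) maff.
- by move=> x _; rewrite lee_fin normal_pdf_ge0.
apply: eq_integral => x _ /=.
rewrite -EFinM !normal_pdfE ?oner_eq0// /normal_peak /normal_fun.
rewrite -!(mulr_natr (_ * pi)) expr1n mul1r -mulrA (sqrtrM _ (sqr_ge0 s)).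
rewrite sqrtr_sqr gtr0_norm// invfM !mulrA divff// mul1r.
congr (_ * expR _)%:E; rewrite -!(mulr_natr (_ ^+ 2)); field.
by rewrite sN0.
Qed.

Lemma normal_prob_norm (m s : R) : normal_prob m s = normal_prob m `|s|.
Proof.
apply/funext => A; apply: eq_integral => x _; rewrite /normal_pdf normr_eq0.
by rewrite /normal_peak /normal_fun real_normK ?num_real.
Qed.

(** Writing a Gaussian law as that of [m + s * Z] with [Z] standard covers the
    degenerate case, which is [s = 0]. *)
Lemma gaussian_affine d (Omega : measurableType d) (P : probability Omega R)
    (Y : Omega -> R) : gaussian P Y ->
  exists m s : R, 0 <= s /\ forall A : set RR, measurable A ->
    P (Y @^-1` A) = normal_prob 0 1 ((fun x : RR => m + s * x) @^-1` A).
Proof.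
move=> [_ [m [s PY]]]; exists m, `|s|; split=> // A mA; rewrite PY//.
have [->|s0] := eqVneq s 0; last first.
  by rewrite normal_prob_norm normal_prob_affine// normr_gt0.
pose N := normal_prob (0 : R) 1 : probability RR R.
have E (x : R) : m + `|0 : R| * x = m by rewrite normr0 mul0r addr0.
have [Am|Am] := pselect (A m).
  rewrite diracE mem_set//.
  rewrite (_ : _ @^-1` A = setT) ?(@probability_setT _ _ _ N)//.
  by apply/seteqP; split => // x _ /=; rewrite E.
rewrite diracE memNset//.
rewrite (_ : _ @^-1` A = set0) ?(measure0 N)//.
by apply/seteqP; split => // x /=; rewrite E.
Qed.

End normal_affine.

(** * Rotations of the standard Gaussian law of the plane *)

Section density.
Context d (T : measurableType d) (R : realType).
Variables (m : {measure set T -> \bar R}) (h : T -> \bar R).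
Hypotheses (mh : measurable_fun setT h) (h0 : forall x, (0 <= h x)%E).

(** The measure of density [h]; the two properties of [h] that make it a measure
    are phantom arguments. *)
Definition density_measure of measurable_fun setT h &
  (forall x, (0 <= h x)%E) := fun A : set T => (\int[m]_(x in A) h x)%E.
Local Notation nu := (density_measure mh h0).

Let nu0 : nu set0 = 0%E.
Proof. by rewrite /density_measure integral_set0. Qed.

Let nu_ge0 A : (0 <= nu A)%E.
Proof. by apply: integral_ge0. Qed.

Let nu_sigma_additive : semi_sigma_additive nu.
Proof.
move=> F mF tF mUF; rewrite /density_measure ge0_integral_bigcup//; last first.
  exact: measurable_funTS.
by apply: is_cvg_ereal_nneg_natsum_cond => n _ _; exact: integral_ge0.
Qed.

HB.instance Definition _ := isMeasure.Build _ _ _ nu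
  nu0 nu_ge0 nu_sigma_additive.

End density.

Section gauss_rotation.
Variable R : realType.
Local Notation leb := (@lebesgue_measure R).
Local Notation RR := (measurableTypeR R).
Local Notation leb2 := (leb \x leb)%E.
Local Notation N01 := (normal_prob (0 : R) 1 : probability RR R).

Lemma measurable_lin (a b : R) : measurable_fun setT
  (fun p : RR * RR => a * p.1 + b * p.2 : RR).
Proof. by apply: measurable_funD; exact: measurable_funM. Qed.

Definition lin2 (a b c d : R) (p : RR * RR) : RR * RR :=
  (a * p.1 + b * p.2, c * p.1 + d * p.2).

Lemma measurable_lin2 a b c d : measurable_fun setT (lin2 a b c d).
Proof. by apply: measurable_fun_pair; exact: measurable_lin. Qed.

Lemma measurable_preimage_lin2 a b c d (B : set (RR * RR)) : measurable B ->
  measurable (lin2 a b c d @^-1` B).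
Proof.
by move=> mB; rewrite -[X in measurable X]setTI; exact: measurable_lin2.
Qed.

Lemma lebesgue_measure_shift (t : R) (A : set RR) : measurable A ->
  leb ((fun x : RR => t + x) @^-1` A) = leb A.
Proof.
move=> mA; rewrite -(lebesgue_measure_affine t ltr01 mA) mul1e.
by congr (leb (_ @^-1` A)); apply/funext => x; rewrite mul1r.
Qed.

(** A vertical shear translates each vertical line. *)
Lemma leb2_vshear (t : R) (B : set (RR * RR)) : measurable B ->
  leb2 (lin2 1 0 t 1 @^-1` B) = leb2 B.
Proof.
move=> mB; apply: eq_integral => x _ /=.
rewrite -(lebesgue_measure_shift (t * x) (measurable_xsection x mB)).
congr (leb _); apply/seteqP; split => y;
  by rewrite /xsection /lin2 /= !inE /= !mul1r mul0r addr0.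
Qed.

(** Each horizontal line is translated; they are integrated over first. *)
Lemma leb2_hshear (t : R) (B : set (RR * RR)) : measurable B ->
  leb2 (lin2 1 t 0 1 @^-1` B) = leb2 B.
Proof.
have E X : measurable X -> leb2 X = (leb \x^ leb)%E X.
  by apply: product_measure_unique => * /=; rewrite product_measure2E.
move=> mB; rewrite (E _ mB) (E _ (measurable_preimage_lin2 1 t 0 1 mB)).
apply: eq_integral => y _ /=.
rewrite -(lebesgue_measure_shift (t * y) (measurable_ysection y mB)).
congr (leb _); apply/seteqP; split => x;
  by rewrite /ysection /lin2 /= !inE /= !mul1r mul0r add0r addrC.
Qed.

(** A rotation of angle [theta] is a product of three shears, with slopes
    [- tan (theta / 2)], [sin theta] and [- tan (theta / 2)]. *)
Lemma leb2_rotation (c s : R) (B : set (RR * RR)) :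
  c ^+ 2 + s ^+ 2 = 1 -> s != 0 -> measurable B ->
  leb2 (lin2 c (- s) s c @^-1` B) = leb2 B.
Proof.
move=> cs s0 mB.
(* [- tan (theta / 2)] when [c = cos theta] and [s = sin theta] *)
pose t := (c - 1) / s.
have -> : lin2 c (- s) s c = lin2 1 t 0 1 \o lin2 1 0 s 1 \o lin2 1 t 0 1.
  apply/funext => -[x y]; rewrite /lin2 /=.
  have c2 : c ^+ 2 = 1 - s ^+ 2 by rewrite -cs addrK.
  by congr pair; rewrite /t; field: c2.
rewrite !comp_preimage leb2_hshear ?leb2_vshear ?leb2_hshear//.
  exact: measurable_preimage_lin2.
by do 2 apply: measurable_preimage_lin2.
Qed.

Let F (p : RR * RR) : \bar R := (normal_pdf 0 1 p.1 * normal_pdf 0 1 p.2)%:E.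

Let mF : measurable_fun setT F.
Proof.
by apply/measurable_EFinP; apply: measurable_funM;
  apply: (measurableT_comp (@measurable_normal_pdf R 0 1)).
Qed.

Let F0 p : (0 <= F p)%E.
Proof. by rewrite lee_fin mulr_ge0// normal_pdf_ge0. Qed.

(** Tonelli on the rectangles, which determine the product measure. *)
Lemma gauss2_density (B : set (RR * RR)) : measurable B ->
  (N01 \x N01)%E B = (\int[leb2]_(p in B) F p)%E.
Proof.
move=> mB.
apply: (@product_measure_unique _ _ _ _ _ N01 N01 (density_measure leb2 mF F0)).
  2: exact: mB.
move=> A C mA mC /=; rewrite /density_measure integral_mkcond.
rewrite fubini_tonelli1; last 2 first.
- by apply/(measurable_restrictT _ (measurableX mA mC)); exact: measurable_funTS.
- by move=> p; apply: erestrict_ge0.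
pose f (x : RR) : \bar R := (normal_pdf 0 1 x)%:E.
have mf : measurable_fun setT f.
  by apply/measurable_EFinP; exact: measurable_normal_pdf.
have f0 x : (0 <= f x)%E by rewrite lee_fin normal_pdf_ge0.
rewrite /normal_prob [X in _ = (X * _)%E]integral_mkcond.
rewrite -ge0_integralZr//; last 3 first.
- exact: ((measurable_restrictT _ mA).1 (measurable_funTS mf)).
- by move=> x _; apply: erestrict_ge0 => z _; exact: f0.
- by apply: integral_ge0 => z _; exact: f0.
apply: eq_integral => x _; rewrite /fubini_F /=.
rewrite [X in (_ * X)%E]integral_mkcond -ge0_integralZl//; last 3 first.
- exact: ((measurable_restrictT _ mC).1 (measurable_funTS mf)).
- by move=> y _; apply: erestrict_ge0 => z _; exact: f0.
- by apply: erestrict_ge0 => z _; exact: f0.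
apply: eq_integral => y _; rewrite /patch.
have [xA|xA] := boolP (x \in A); have [yC|yC] := boolP (y \in C).
- by rewrite mem_set//; split; exact: set_mem.
- by rewrite memNset ?mule0// => -[_] /= /mem_set yC'; rewrite yC' in yC.
- by rewrite memNset ?mul0e// => -[/= /mem_set xA']; rewrite xA' in xA.
- by rewrite memNset ?mul0e// => -[/= /mem_set xA']; rewrite xA' in xA.
Qed.

(** Both Lebesgue measure and the density, a function of [x ^+ 2 + y ^+ 2], are
    invariant. *)
Lemma gauss2_rotation (c s : R) (B : set (RR * RR)) :
  c ^+ 2 + s ^+ 2 = 1 -> s != 0 -> measurable B ->
  (N01 \x N01)%E (lin2 c (- s) s c @^-1` B) = (N01 \x N01)%E B.
Proof.
move=> cs s0 mB; have mB' := measurable_preimage_lin2 c (-s) s c mB.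
rewrite !gauss2_density//.
rewrite [RHS](@eq_measure_integral _ _ _ _
  (image_measure leb2 (measurable_lin2 c (-s) s c))); last first.
  by move=> A mA _ /=; rewrite -(leb2_rotation cs s0 mA).
rewrite (ge0_integral_image leb2 _ mB mF F0); apply: eq_integral => -[x y] _.
rewrite /F /lin2 /= !normal_pdfE ?oner_eq0// /normal_fun.
rewrite mulrACA -[in RHS]mulrACA -!expRD; congr (_ * expR _)%:E.
have c2 : c ^+ 2 = 1 - s ^+ 2 by rewrite -cs addrK.
by field: c2.
Qed.

End gauss_rotation.

(** * Rotation invariant laws and centered normal laws *)

Lemma product_prob_rectangle_eq d (T : measurableType d) (R : realType)
    (P : probability T R) (A B : set T) : measurable A -> measurable B ->
  (P \x P)%E (setT `*` B) = (P \x P)%E (A `*` setT) -> P B = P A.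
Proof.
move=> mA mB; rewrite !product_measure1E// => PBA.
have PT : P setT = 1%E by exact: probability_setT.
have: (P setT * P B = P A * P setT)%E by exact: PBA.
by rewrite PT mul1e mule1.
Qed.

Section rotation_invariance.
Variable R : realType.
Local Notation RR := (measurableTypeR R).
Local Notation N01 := (normal_prob (0 : R) 1 : probability RR R).

(** The matrix is that of the rotation with cosine [c] and sine [s]; the case
    [s != 0] is the one that the shears give, and the only one met when
    a nonzero entry of a matrix is eliminated. *)
Definition rotation_invariant (gam : probability RR R) := forall c s B,
  c ^+ 2 + s ^+ 2 = 1 -> s != 0 -> measurable B ->
  (gam \x gam)%E (lin2 c (- s) s c @^-1` B) = (gam \x gam)%E B.

(** A quarter turn maps [(x, y)] to [(- y, x)], so that the laws of [x] and
    [- y] agree. *)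
Lemma rotation_invariant_opp (gam : probability RR R) (A : set RR) :
  rotation_invariant gam -> measurable A ->
  gam ((fun x : RR => - x) @^-1` A) = gam A.
Proof.
move=> rot mA.
have mN : measurable ((fun x : RR => - x) @^-1` A).
  by rewrite -[X in measurable X]setTI; exact: oppr_measurable.
have := rot 0 1 (A `*` setT); rewrite expr0n expr1n add0r oner_eq0.
move=> /(_ erefl isT (measurableX mA measurableT)).
have -> : lin2 0 (- 1) 1 0 @^-1` (A `*` setT) =
    setT `*` ((fun x : RR => - x) @^-1` A).
  by apply/seteqP; split => -[x y] /=; rewrite mul0r add0r mulN1r => -[].
by move/(product_prob_rectangle_eq mA mN).
Qed.

Definition scaling (s : R) : RR -> RR := fun x => s * x.

Lemma measurable_scaling s : measurable_fun setT (scaling s).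
Proof. exact: mulrl_measurable. Qed.

HB.instance Definition _ s :=
  isMeasurableFun.Build _ _ _ _ (scaling s) (measurable_scaling s).

(** The law of [s * Z] for a standard [Z], so that [s = 0] gives the Dirac mass
    at [0]. *)
Definition centered_normal (s : R) : probability RR R :=
  distribution N01 (scaling s).

Lemma centered_normalE s A :
  centered_normal s A = normal_prob 0 1 ((fun x : RR => s * x) @^-1` A).
Proof. by []. Qed.

(** Homotheties commute with rotations. *)
Lemma centered_normal_rotation s : rotation_invariant (centered_normal s).
Proof.
move=> c d B cd d0 mB; have mB' := measurable_preimage_lin2 c (- d) d c mB.
have E X : measurable X -> (centered_normal s \x centered_normal s)%E X =
    (N01 \x N01)%E (lin2 s 0 0 s @^-1` X).
  apply: (@product_measure_unique _ _ _ _ _ (centered_normal s)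
    (centered_normal s) (image_measure (N01 \x N01)%E
      (measurable_lin2 s 0 0 s))) => A C mA mC.
  rewrite [LHS](_ : _ = (N01 \x N01)%E ((scaling s @^-1` A) `*`
    (scaling s @^-1` C))).
    by apply: product_measure1E; rewrite -[X in measurable X]setTI;
      exact: measurable_scaling.
  congr ((N01 \x N01)%E _); apply/seteqP.
  by split => -[x y]; rewrite /lin2 /scaling /= !mul0r add0r addr0.
rewrite (E _ mB') (E _ mB).
rewrite -(gauss2_rotation cd d0 (measurable_preimage_lin2 s 0 0 s mB)).
have comm : lin2 c (- d) d c \o lin2 s 0 0 s = lin2 s 0 0 s \o lin2 c (- d) d c.
  by apply/funext => -[x y]; rewrite /lin2 /=; congr pair; ring.
by rewrite -2!comp_preimage comm.
Qed.

End rotation_invariance.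

Section gaussian_moments.
Variable R : realType.
Local Notation RR := (measurableTypeR R).
Local Notation N01 := (normal_prob (0 : R) 1 : probability RR R).

(** This is [1], but only its positivity matters below: equal second moments
    force equal scales whatever its value. *)
Definition normal_moment2 : \bar R := (\int[N01]_x (x ^+ 2)%:E)%E.

(** Otherwise a standard variable would vanish almost surely, whereas its law is
    absolutely continuous. *)
Lemma normal_moment2_gt0 : (0 < normal_moment2)%E.
Proof.
have m2 : measurable_fun setT (fun x : RR => (x ^+ 2)%:E).
  by apply/measurable_EFinP; exact: exprn_measurable.
have M0 : (0 <= normal_moment2)%E.
  by apply: integral_ge0 => x _; rewrite lee_fin sqr_ge0.
rewrite lt0e M0 andbT; apply/negP => /eqP M00.
have : (\int[N01]_(x in setT) `|(x ^+ 2)%:E| = 0)%E.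
  by rewrite -M00; apply: eq_integral => x _; rewrite gee0_abs// lee_fin sqr_ge0.
move=> /(ae_eq_integral_abs _ measurableT m2)[A [mA A0 sA]].
have N0 : N01 [set 0] = 0%E.
  have /null_content_dominatesP dom := @normal_prob_dominates R 0 1.
  by apply: dom => //; exact: lebesgue_measure_set1.
suff : (N01 setT <= N01 A + N01 [set 0%R])%E.
  by rewrite (probability_setT N01) A0 N0 adde0 lee_fin ler10.
apply: le_trans (measureU2 _ _ _) => //.
apply: le_measure; rewrite ?inE//; first exact: measurableU.
move=> x _; have [->|x0] := eqVneq x 0; first by right.
left; apply: sA => /= /(_ I) [] /eqP.
by rewrite expf_eq0 /= (negbTE x0).
Qed.

(** The second moment determines the scale.  If [normal_moment2] were infinite,
    then [a] would be [0], and so is the right-hand side because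
    [fine +oo = 0]. *)
Lemma normal_scale_of_moment2 (a c : R) : 0 <= a ->
  ((a ^+ 2)%:E * normal_moment2 = c%:E)%E ->
  a = Num.sqrt (c / fine normal_moment2).
Proof.
move=> a0; have := normal_moment2_gt0; case: normal_moment2 => [r| |]//=.
  rewrite lte_fin => r0 -[<-].
  by rewrite mulfK ?gt_eqF// sqrtr_sqr ger0_norm.
move=> _; rewrite invr0 mulr0 sqrtr0; have [->//|aN0] := eqVneq a 0.
by rewrite gt0_muley// lte_fin exprn_even_gt0.
Qed.

(** With [Y] distributed as [m + s * Z], the finite second moment makes [s * Z]
    integrable and its mean vanishes by symmetry, so that [m] is the mean of
    [Y]. *)
Lemma centered_gaussian_law d (Omega : measurableType d)
    (P : probability Omega R) (Y : Omega -> R) (v : R) :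
  gaussian P Y -> centered P Y -> ('E_P[fun w => (Y w ^+ 2)%R] = v%:E)%E ->
  exists s, [/\ 0 <= s, ((s ^+ 2)%:E * normal_moment2 = v%:E)%E &
    forall A : set RR, measurable A -> P (Y @^-1` A) = centered_normal s A].
Proof.
move=> gY cY vY; have [mY0 _] := gY.
have mY : measurable_fun setT (Y : Omega -> RR) by exact: mY0.
have [m [s [s0 PY]]] := gaussian_affine gY.
have maff := @measurable_affine R m s.
have law (A : set RR) : measurable A ->
  image_measure P mY A = image_measure N01 maff A by exact: PY.
have E2 : (\int[N01]_x ((m + s * x) ^+ 2)%:E = v%:E)%E.
  rewrite -vY unlock.
  have msq : measurable_fun setT (fun y : RR => (y ^+ 2)%:E).
    by apply/measurable_EFinP; exact: exprn_measurable.
  have sq0 (y : RR) : (0 <= (y ^+ 2)%:E)%E by rewrite lee_fin sqr_ge0.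
  rewrite -(ge0_integral_image _ maff measurableT msq sq0).
  rewrite -[RHS](ge0_integral_image _ mY measurableT msq sq0).
  by apply: eq_measure_integral => A mA _; rewrite law.
(* square integrable functions are integrable, since [`|y| <= 1 + y ^+ 2] *)
have intg d' (T : measurableType d') (Q : probability T R) (f : T -> R) :
    measurable_fun setT f -> (\int[Q]_x (f x ^+ 2)%:E = v%:E)%E ->
    Q.-integrable setT (EFin \o f).
  move=> mf f2.
  apply: (@le_integrable _ _ _ _ _ measurableT _ (EFin \o (cst 1 \+ (fun x => f x ^+ 2)))).
  - exact/measurable_EFinP.
  - move=> x _; rewrite lee_fin /= [leRHS]ger0_norm ?addr_ge0 ?sqr_ge0//.
    rewrite -(real_normK (num_real (f x))).
    have := sqr_ge0 (`|f x| - 1); have := normr_ge0 (f x); nra.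
  - rewrite (_ : _ \o _ = (cst 1 \+ (fun x => (f x ^+ 2)%:E))%E)//.
    apply: integrableD => //; first exact: finite_measure_integrable_cst.
    apply/integrableP; split.
      by apply/measurable_EFinP; exact: measurable_funX.
    under eq_integral do rewrite /= ger0_norm ?sqr_ge0//.
    by rewrite f2 ltry.
have iY : P.-integrable setT (EFin \o Y).
  by apply: intg => //; rewrite -vY unlock.
have iaff := intg _ _ N01 _ maff E2.
have E1 : (\int[N01]_x (m + s * x)%:E = 0)%E.
  rewrite -cY unlock.
  have mid : measurable_fun setT (fun y : RR => y%:E) by exact/measurable_EFinP.
  rewrite -[LHS](integral_pushforward maff mid iaff measurableT).
  rewrite -[RHS](integral_pushforward mY mid iY measurableT).
  by apply: (eq_measure_integral (image_measure P mY)) => A mA _; rewrite -law.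
have isx : N01.-integrable setT (fun x : RR => (s * x)%:E).
  rewrite (_ : (fun x => _) = (fun x => (m + s * x)%:E) \- cst m%:E)%E; last first.
    by apply/funext => x /=; rewrite -EFinB addrAC subrr add0r.
  by apply: integrableB => //; exact: finite_measure_integrable_cst.
have m0 : m = 0.
  move: E1; under eq_integral do rewrite EFinD.
  rewrite integralD//; last exact: finite_measure_integrable_cst.
  rewrite integral_cst// [X in (_ * X)%E](probability_setT N01) mule1.
  set I := (\int[N01]_x (s * x)%:E)%E => mI.
  have finI : I \is a fin_num by exact: integrable_fin_num.
  have mopp : measurable_fun setT (fun x : RR => - x : RR) by exact: oppr_measurable.
  have isN : N01.-integrable setT (fun x : RR => (s * - x)%:E).
    rewrite (_ : (fun x => _) = \- (fun x : RR => (s * x)%:E))%E.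
      exact: integrableN.
    by apply/funext => x /=; rewrite mulrN.
  have IN : I = (- I)%E.
    rewrite -integralN; last exact: integrable_add_def.
    have mf : measurable_fun setT (fun x : RR => (s * x)%:E).
      by case/integrableP: isx.
    transitivity (\int[image_measure N01 mopp]_x (s * x)%:E)%E.
      apply: (eq_measure_integral (image_measure N01 mopp)) => A mA _.
      exact/esym/(rotation_invariant_opp (@gauss2_rotation R) mA).
    rewrite (integral_pushforward mopp mf isN measurableT).
    by apply: eq_integral => x _ /=; rewrite mulrN.
  move: mI finI IN; case: I => [r| |]//= [mr] _ [rN].
  by move: mr rN; lra.
exists s; split=> //; last by move=> A mA; rewrite PY// m0; under eq_fun do rewrite add0r.
rewrite -E2 m0 -ge0_integralZl//.
- by apply: eq_integral => x _; rewrite add0r exprMn EFinM.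
- by apply/measurable_EFinP; exact: exprn_measurable.
- by move=> x _; rewrite lee_fin sqr_ge0.
- by rewrite lee_fin sqr_ge0.
Qed.

End gaussian_moments.

(** * Independent families and orthogonal matrices *)

Section iid_families.
Context (R : realType) d (Omega : measurableType d) (P : probability Omega R).
Local Notation RR := (measurableTypeR R).
Variable gam : probability RR R.

(** Independence and identity of the laws in one formula, on boxes, which suits
    both the induction and the uniqueness argument of [iid_tuple_law]. *)
Definition iid (I : finType) (xi : I -> Omega -> RR) : Prop :=
  (forall i, measurable_fun setT (xi i)) /\
  forall A : I -> set RR, (forall i, measurable (A i)) ->
    P [set w | forall i, A i (xi i w)] = (\prod_i gam (A i))%E.

Lemma measurable_forall (I : finType) (S : I -> set Omega) :
  (forall i, measurable (S i)) -> measurable [set w | forall i, S i w].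
Proof.
move=> mS; rewrite (_ : mkset _ = \big[setI/setT]_(i : I) S i).
  by apply: bigsetI_measurable.
apply/seteqP; split => w /=; first by move=> Sw; rewrite -bigcap_seq => i _; exact: Sw.
by rewrite -bigcap_seq => Sw i; apply: Sw; rewrite /= mem_index_enum.
Qed.

(** Rectangles form a generating family stable under intersection. *)
Lemma measure_rectangle_unique (m1 m2 : {measure set (RR * RR) -> \bar R}) :
  (m1 setT < +oo)%E ->
  (forall A B, measurable A -> measurable B -> m1 (A `*` B) = m2 (A `*` B)) ->
  forall X, measurable X -> m1 X = m2 X.
Proof.
move=> m1T m12 X mX.
pose C : set (set (RR * RR)) :=
  [set C | exists A, measurable A /\ exists B, measurable B /\ C = A `*` B].
apply: (measure_unique C (fun=> setT)) => //.
- rewrite measurable_prod_measurableType //; congr (<<s _ >>).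
  rewrite predeqE; split => [[A mA [B mB <-]]|[A [mA [B [mB ->]]]]].
    by exists A; split => //; exists B.
  by exists A => //; exists B.
- move=> /= _ _ [X1 [mX1 [X2 [mX2 ->]]]] [Y1 [mY1 [Y2 [mY2 ->]]]].
  rewrite -setXI; exists (X1 `&` Y1); split; first exact: measurableI.
  by exists (X2 `&` Y2); split => //; exact: measurableI.
- by move=> _; exists setT; split => //; exists setT; rewrite setXTT.
- by rewrite bigcup_const//; exists 0%N.
- by move=> A [A1 [mA1 [A2 [mA2 ->]]]]; exact: m12.
Qed.

Section moves.
Variables (I : finType).
Implicit Types xi : I -> Omega -> RR.

Definition givens (c s : R) (i j : I) xi : I -> Omega -> RR := fun k w =>
  if k == i then c * xi i w + - s * xi j w
  else if k == j then s * xi i w + c * xi j w else xi k w.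

(** Restricted to the event [E] where the other coordinates lie in their
    prescribed sets, the law [nu] of the pair [(xi i, xi j)] is a multiple of
    [gam \x gam], because it is so on rectangles; rotating the pair therefore
    changes nothing. *)
Lemma iid_givens c s i j xi : rotation_invariant gam -> i != j ->
  c ^+ 2 + s ^+ 2 = 1 -> s != 0 -> iid xi -> iid (givens c s i j xi).
Proof.
move=> rot ij cs s0 [mxi Pxi]; have ji : j != i by rewrite eq_sym.
have mg k : measurable_fun setT (givens c s i j xi k).
  rewrite /givens; case: (k == i); last case: (k == j) => //.
    by apply: measurable_funD; apply: measurable_funM => //; exact: mxi.
  by apply: measurable_funD; apply: measurable_funM => //; exact: mxi.
split=> // A mA.
pose E := [set w | forall k, ((k != i) && (k != j)) -> A k (xi k w)].
have mE : measurable E.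
  apply: (@measurable_forall I
    (fun k => [set w | (k != i) && (k != j) -> A k (xi k w)])) => k.
  case: (_ && _); last first.
    by rewrite (_ : mkset _ = setT)//; apply/seteqP; split.
  rewrite (_ : mkset _ = xi k @^-1` A k).
    by rewrite -[X in measurable X]setTI; exact: mxi.
  by apply/seteqP; split => w /=; [apply|].
have mpair : measurable_fun setT (fun w => (xi i w, xi j w)).
  exact: measurable_fun_pair.
pose q := (\prod_(k | (k != i) && (k != j)) gam (A k))%E.
have q0 : (0 <= q)%E by apply: prode_ge0 => k _; exact: measure_ge0.
have qfin : q \is a fin_num by apply: prode_fin_num => k _; exact: fin_num_measure.
have splitP (A' : I -> set RR) :
    (\prod_k gam (A' k) = gam (A' i) * (gam (A' j) *
      \prod_(k | (k != i) && (k != j)) gam (A' k)))%E.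
  by rewrite (bigD1 i)//= (bigD1 j).
pose nu := image_measure (mrestr P mE) mpair.
pose fq : {nonneg R} := NngNum (fine_ge0 q0).
have nuE X : measurable X -> nu X = (q * (gam \x gam) X)%E.
  move=> mX; transitivity (mscale fq (gam \x gam)%E X); last first.
    by rewrite /mscale /= fineK.
  apply: measure_rectangle_unique mX => [|C D mC mD].
    rewrite /nu /= /pushforward /mrestr preimage_setT setTI.
    by rewrite (le_lt_trans (probability_le1 _ _))// ltry.
  transitivity (q * (gam C * gam D))%E; last first.
    by rewrite -{1}(fineK qfin) -(product_measure1E gam gam mC mD).
  pose A' k := if k == i then C else if k == j then D else A k.
  have mA' k : measurable (A' k) by rewrite /A'; case: ifP => // _; case: ifP.
  transitivity (P [set w | forall k, A' k (xi k w)]).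
    rewrite /nu /= /pushforward /mrestr; congr (P _); apply/seteqP; split=> w /=.
      move=> [[Ci Dj] Ew] k; rewrite /A'; have [->//|ki] := eqVneq k i.
      by have [->//|kj] := eqVneq k j; apply: Ew; rewrite ki.
    move=> A'w; split.
      split; first by have := A'w i; rewrite /A' eqxx.
      by have := A'w j; rewrite /A' eqxx (negbTE ji).
    by move=> k /andP[ki kj]; have := A'w k; rewrite /A' (negbTE ki) (negbTE kj).
  rewrite Pxi// splitP /A' eqxx (negbTE ji) eqxx muleA muleC; congr (_ * _)%E.
  by apply: eq_bigr => k /andP[/negbTE-> /negbTE->].
rewrite splitP muleA muleC.
transitivity (nu (lin2 c (- s) s c @^-1` (A i `*` A j))).
  rewrite /nu /= /pushforward /mrestr; congr (P _); apply/seteqP; split=> w /=.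
    move=> Aw; split.
      split; first by have := Aw i; rewrite /givens eqxx.
      by have := Aw j; rewrite /givens eqxx (negbTE ji).
    by move=> k /andP[ki kj]; have := Aw k; rewrite /givens (negbTE ki) (negbTE kj).
  move=> [[Ai Aj] Ew] k; rewrite /givens; have [->//|ki] := eqVneq k i.
  by have [->//|kj] := eqVneq k j; apply: Ew; rewrite ki.
rewrite nuE; last by apply: measurable_preimage_lin2; exact: measurableX.
by rewrite (rot _ _ _ cs s0 (measurableX (mA i) (mA j))) product_measure1E.
Qed.

Lemma iid_sign (e : R) i xi : rotation_invariant gam -> e ^+ 2 = 1 -> iid xi ->
  iid (fun k w => if k == i then e * xi k w else xi k w).
Proof.
move=> rot /eqP; rewrite sqrf_eq1 => /orP[/eqP->|/eqP->] [mxi Pxi].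
  rewrite (_ : (fun k w => _) = xi)//; apply/funext => k; apply/funext => w.
  by rewrite mul1r if_same.
have mN (A : set RR) : measurable A -> measurable ((fun x : RR => - x) @^-1` A).
  by move=> mA; rewrite -[X in measurable X]setTI; exact: oppr_measurable.
split=> [k|A mA].
  by case: (k == i) => //; apply: measurable_funM => //; exact: mxi.
pose A' k := if k == i then (fun x : RR => - x) @^-1` A k else A k.
transitivity (P [set w | forall k, A' k (xi k w)]).
  congr (P _); apply/seteqP; split=> w /= Aw k; have := Aw k;
    by rewrite /A'; case: (k == i); rewrite ?mulN1r.
rewrite (Pxi A'); last by move=> k; rewrite /A'; case: (k == i) => //; exact: mN.
apply: eq_bigr => k _; rewrite /A'; case: (k == i) => //; exact: rotation_invariant_opp.
Qed.

End moves.

Section orthogonal.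
Variables (I : finType).
Implicit Types (O : I -> I -> R).

Definition orthonormal_cols O :=
  forall p q, \sum_k O k p * O k q = (p == q)%:R.

Definition linear_mix O (xi : I -> Omega -> RR) : I -> Omega -> RR :=
  fun k w => \sum_p O k p * xi p w.

(** Givens elimination.  The outer induction is on the size of the set
    [S] of the columns that are not yet those of the identity matrix; the inner
    one is on the number of nonzero entries outside the diagonal in the column
    [k] of [S] being treated. *)
Lemma iid_orthogonal O xi : rotation_invariant gam -> orthonormal_cols O ->
  iid xi -> iid (linear_mix O xi).
Proof.
move=> rot; have [m] := ubnP #|[set: I]%SET|.
have : forall p, p \notin [set: I]%SET -> forall k, O k p = (k == p)%:R.
  by move=> p; rewrite inE.
elim: m [set: I]%SET O xi => // m IHm S O xi.
have [->|[k kS]] := set_0Vmem S.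
  move=> O1 _ _ ixi; rewrite (_ : linear_mix O xi = xi)//.
  apply/funext => k; apply/funext => w; rewrite /linear_mix (bigD1 k)//=.
  rewrite O1 ?inE// eqxx mul1r big1 ?addr0// => p pk.
  by rewrite O1 ?inE// eq_sym (negbTE pk) mul0r.
have [e] := ubnP #|[set i | (i != k) && (O i k != 0)]%SET|.
elim: e O xi => // e IHe O xi le_e O1 le_m orth ixi.
have Skm : (#|S :\ k| < m)%N by move: le_m; rewrite (cardsD1 k) kS.
(* without nonzero entries outside the diagonal, column [k] is that of the
   identity up to the sign of [O k k] *)
have [Z|[i iZ]] := set_0Vmem [set i | (i != k) && (O i k != 0)]%SET.
  have Oik i : i != k -> O i k = 0.
    move=> ik; apply/eqP; apply: contraT => Oik.
    by have := finset.in_set0 i; rewrite -Z inE ik Oik.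
  have Okk : O k k ^+ 2 = 1.
    have := orth k k; rewrite (bigD1 k)//= big1 ?addr0 ?eqxx// => i ik.
    by rewrite Oik// mul0r.
  pose O' i p := if i == k then O k k * O i p else O i p.
  have -> : linear_mix O xi = fun i w =>
      if i == k then O k k * linear_mix O' xi i w else linear_mix O' xi i w.
    apply/funext => i; apply/funext => w; rewrite /linear_mix /O'.
    have [->|//] := eqVneq i k; rewrite mulr_sumr; apply: eq_bigr => p _.
    by rewrite !mulrA -expr2 Okk mul1r.
  apply: iid_sign => //; apply: (IHm (S :\ k)) => //.
    move=> p; rewrite !inE negb_and negbK /O' => /orP[/eqP->|pS] i.
      by have [->|ik] := eqVneq i k; [rewrite -expr2|rewrite Oik].
    rewrite (O1 p pS); have [->|//] := eqVneq i k.
    have [kp|] := eqVneq k p; last by rewrite mulr0.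
    by move: pS; rewrite -kp kS.
  move=> p q; rewrite -orth; apply: eq_bigr => i _; rewrite /O'.
  have [->|//] := eqVneq i k.
  by rewrite mulrACA -expr2 Okk mul1r.
move: iZ; rewrite inE => /andP[ik Oik].
have ki : k != i by rewrite eq_sym.
(* otherwise column [i] would be that of the identity, and orthogonality to
   column [k] would give [O i k = 0] *)
have iS : i \in S.
  apply: contraT => iS; have := orth i k; rewrite (bigD1 i)//= big1 ?addr0.
    by rewrite O1// eqxx mul1r (negbTE ik) => /eqP; rewrite (negbTE Oik).
  by move=> j ji; rewrite O1// (negbTE ji) mul0r.
pose r2 := O k k ^+ 2 + O i k ^+ 2.
have r2_gt0 : 0 < r2 by rewrite ltr_wpDl ?sqr_ge0// exprn_even_gt0.
pose r := Num.sqrt r2.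
have r0 : r != 0 by rewrite gt_eqF// sqrtr_gt0.
have rr : r ^+ 2 = r2 by rewrite sqr_sqrtr// ltW.
(* the rotation of the rows [k] and [i] that cancels the entry [O i k]; both
   rows vanish in the columns outside [S], which are thus preserved *)
pose c := O k k / r; pose s := O i k / r.
have cs : c ^+ 2 + s ^+ 2 = 1.
  by rewrite !expr_div_n -mulrDl -/r2 -rr divff// expf_neq0.
have s0 : s != 0 by rewrite mulf_neq0// invr_eq0.
pose O' j p := if j == k then c * O k p + s * O i p
  else if j == i then - s * O k p + c * O i p else O j p.
have -> : linear_mix O xi = givens c s k i (linear_mix O' xi).
  have c2 : c ^+ 2 = 1 - s ^+ 2 by rewrite -cs addrK.
  apply/funext => j; apply/funext => w; rewrite /givens /linear_mix /O'.
  rewrite !eqxx (negbTE ik).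
  have [->|jk] := eqVneq j k.
    rewrite !mulr_sumr -big_split; apply: eq_bigr => p _ /=.
    transitivity ((c ^+ 2 + s ^+ 2) * O k p * xi p w); first by rewrite cs mul1r.
    by ring.
  have [->|ji //] := eqVneq j i.
  rewrite !mulr_sumr -big_split; apply: eq_bigr => p _ /=.
  transitivity ((c ^+ 2 + s ^+ 2) * O i p * xi p w); first by rewrite cs mul1r.
  by ring.
apply: iid_givens => //; apply: IHe => //.
- rewrite ltnS in le_e; apply: leq_trans le_e; apply: proper_card; apply/properP; split.
    apply/fintype.subsetP => j; rewrite !inE /O' => /andP[jk].
    rewrite (negbTE jk); have [->|ji] := eqVneq j i; rewrite ?ik ?Oik // jk.
  exists i; rewrite !inE ?ik// /O' (negbTE ik) eqxx negbK.
  by apply/eqP; rewrite /s /c; field.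
- move=> p pS j; rewrite /O' !O1//.
  have kp : k != p by apply: contraNneq pS => <-.
  have ip : i != p by apply: contraNneq pS => <-.
  have [->|jk] := eqVneq j k; first by rewrite (negbTE kp) (negbTE ip) !mulr0 addr0.
  have [->|ji //] := eqVneq j i.
  by rewrite (negbTE kp) (negbTE ip) !mulr0 addr0.
move=> p q; rewrite -orth [RHS](bigD1 k)//= [LHS](bigD1 k)//=.
rewrite (bigD1 i)//= [in RHS](bigD1 i)//= /O' !eqxx (negbTE ik) !addrA.
congr (_ + _); last first.
  by apply: eq_bigr => j /andP[/negbTE-> /negbTE->].
transitivity ((c ^+ 2 + s ^+ 2) * (O k p * O k q + O i p * O i q)).
  by ring.
by rewrite cs mul1r.
Qed.

End orthogonal.

(** Boxes generate the sigma-algebra of the tuples and are stable under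
    intersection, and [iid] prescribes the probability of each of them. *)
Lemma iid_tuple_law n (xi eta : 'I_n -> Omega -> RR) (B : set (n.-tuple RR)) :
  iid xi -> iid eta -> measurable B ->
  P ((fun w => [tuple xi i w | i < n]) @^-1` B) =
  P ((fun w => [tuple eta i w | i < n]) @^-1` B).
Proof.
move=> [mxi Pxi] [meta Peta] mB.
have mtup (f : 'I_n -> Omega -> RR) : (forall i, measurable_fun setT (f i)) ->
    measurable_fun setT (fun w => [tuple f i w | i < n]).
  move=> mf; apply/measurable_fun_tnthP => i; rewrite (_ : _ \o _ = f i)//.
  by apply/funext => w /=; rewrite tnth_mktuple.
pose box (A : 'I_n -> set RR) := [set t : n.-tuple RR | forall i, A i (tnth t i)].
pose C := [set box A | A in [set A | forall i, measurable (A i)]].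
have mbox A : (forall i, measurable (A i)) -> measurable (box A).
  move=> mA; rewrite (_ : box A = \big[setI/setT]_(i < n) ((@tnth n RR)^~ i @^-1` A i)).
    apply: bigsetI_measurable => i _.
    by rewrite -[X in measurable X]setTI; exact: measurable_tnth.
  apply/seteqP; split => t /=; rewrite -bigcap_seq => At i; first by move=> _; exact: At.
  by apply: At; rewrite /= mem_index_enum.
have boxP (f : 'I_n -> Omega -> RR) A :
    (fun w => [tuple f i w | i < n]) @^-1` box A = [set w | forall i, A i (f i w)].
  by apply/seteqP; split => w /= Aw i; have := Aw i; rewrite tnth_mktuple.
apply: (measure_unique C (fun=> setT) _ _ _ _
  (image_measure P (mtup _ mxi)) (image_measure P (mtup _ meta))) mB => //.
- apply/seteqP; split; last first.
    apply: smallest_sub; first exact: sigma_algebra_measurable.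
    by move=> _ [A mA <-]; exact: mbox.
  apply: smallest_sub; first exact: smallest_sigma_algebra.
  move=> X; rewrite -bigcup_seq => -[i _ [Y mY <-]].
  apply: sub_gen_smallest; exists (fun j => if j == i then Y else setT).
    by move=> j; case: ifP.
  apply/seteqP; split => t /=.
    by move=> /(_ i); rewrite eqxx.
  by move=> [_ Yt] j; case: eqP => // ->.
- move=> _ _ [A mA <-] [A' mA' <-]; exists (fun i => A i `&` A' i).
    by move=> i; exact: measurableI.
  apply/seteqP; split => t /=.
    by move=> AA; split => i; have [] := AA i.
  by move=> [At A't] i; split.
- by move=> _; exists (fun=> setT) => //; apply/seteqP; split.
- by rewrite bigcup_const//; exists 0%N.
- move=> _ [A mA <-].
  transitivity (P [set w | forall i, A i (xi i w)]); first by rewrite -boxP.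
  transitivity (P [set w | forall i, A i (eta i w)]); last by rewrite -boxP.
  by rewrite Pxi// Peta.
- move=> _; rewrite /= /pushforward preimage_setT.
  by rewrite probability_setT ltry.
Qed.

End iid_families.

(** * Integrals of products of square integrable functions *)

Section complex_measurability.
Context (R : realType) d (T : measurableType d).
Local Notation reim := (fun z : R[i] => (complex.Re z, complex.Im z) : R * R).

Lemma measurable_ReIm (f : T -> R[i]) :
  measurable_fun setT f <->
  measurable_fun setT (fun x => complex.Re (f x)) /\
  measurable_fun setT (fun x => complex.Im (f x)).
Proof.
split=> [mf|[mr mi]].
  have mri : measurable_fun setT reim by move=> _ A mA; rewrite setTI; exists A; rewrite ?setTI.
  have mp : measurable_fun setT (reim \o f) by exact: measurableT_comp.
  split; first exact: (measurableT_comp measurable_fst mp).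
  exact: (measurableT_comp measurable_snd mp).
have mp : measurable_fun setT (reim \o f) by exact: measurable_fun_pair.
by move=> _ A [B mB <-]; have := mp measurableT B mB; rewrite !setTI.
Qed.

End complex_measurability.

Section Rintegral_facts.
Context (R : realType) d (T : measurableType d) (m : {measure set T -> \bar R}).

(** When the positive or the negative part has an infinite integral, both sides
    are [0]. *)
Lemma Rintegral_opp (f : T -> R) :
  \int[m]_x (- f x) = - \int[m]_x f x.
Proof.
rewrite /Rintegral [in LHS]integralE [in RHS]integralE.
rewrite (_ : (fun x => (- f x)%:E) = \- (EFin \o f))%E; last by apply/funext.
rewrite funeposN funenegN -/(EFin \o f).
have : (0 <= \int[m]_x (EFin \o f)^\+ x)%E by apply: integral_ge0.
have : (0 <= \int[m]_x (EFin \o f)^\- x)%E by apply: integral_ge0.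
case: (\int[m]_x (EFin \o f)^\+ x)%E; case: (\int[m]_x (EFin \o f)^\- x)%E => //=;
  rewrite ?oppr0// => a b _ _.
by rewrite opprB.
Qed.

Lemma integrable_sumR (I : eqType) (s : seq I) (F : I -> T -> R) :
  {in s, forall i, m.-integrable setT (EFin \o F i)} ->
  m.-integrable setT (EFin \o (fun x => \sum_(i <- s) F i x)).
Proof.
move=> iF; rewrite (_ : _ \o _ = fun x => (\sum_(i <- s | i \in s) (F i x)%:E)%E).
  exact: (integrable_sum measurableT s (h := fun i => EFin \o F i)).
by apply/funext => x /=; rewrite sumEFin -big_seq.
Qed.

Lemma Rintegral_sum (I : eqType) (s : seq I) (F : I -> T -> R) :
  {in s, forall i, m.-integrable setT (EFin \o F i)} ->
  \int[m]_x (\sum_(i <- s) F i x) = \sum_(i <- s) \int[m]_x F i x.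
Proof.
elim: s => [|i s IHs] iF.
  under eq_Rintegral do rewrite big_nil.
  by rewrite Rintegral_cst// mul0r big_nil.
have iFs : {in s, forall j, m.-integrable setT (EFin \o F j)}.
  by move=> j js; apply: iF; rewrite inE js orbT.
under eq_Rintegral do rewrite big_cons.
rewrite RintegralD// ?IHs ?big_cons//; last exact: integrable_sumR.
by apply: iF; rewrite mem_head.
Qed.

Definition square_integrable (f : T -> R) :=
  measurable_fun setT f /\ (\int[m]_x (f x ^+ 2)%:E < +oo)%E.

Lemma square_integrableZ (r : R) (f : T -> R) :
  square_integrable f -> square_integrable (fun x => r * f x).
Proof.
move=> [mf f2]; split; first exact: measurable_funM.
under eq_integral do rewrite exprMn EFinM.
rewrite ge0_integralZl//.
- by rewrite lte_mul_pinfty// lee_fin sqr_ge0.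
- by apply/measurable_EFinP; exact: measurable_funX.
- by move=> x _; rewrite lee_fin sqr_ge0.
- by rewrite lee_fin sqr_ge0.
Qed.

Lemma square_integrableM (f h : T -> R) :
  square_integrable f -> square_integrable h ->
  m.-integrable setT (EFin \o (fun x => f x * h x)).
Proof.
have sq g : square_integrable g -> m.-integrable setT (fun x => (g x ^+ 2)%:E).
  move=> [mg g2]; apply/integrableP; split.
    by apply/measurable_EFinP; exact: measurable_funX.
  by under eq_integral do rewrite gee0_abs ?lee_fin ?sqr_ge0//.
move=> f2 h2.
apply: (@le_integrable _ _ _ _ _ measurableT _
  (fun x => (f x ^+ 2)%:E + (h x ^+ 2)%:E)%E).
- by apply/measurable_EFinP; apply: measurable_funM; [case: f2|case: h2].
- move=> x _; rewrite lee_fin [leRHS]ger0_norm ?addr_ge0 ?sqr_ge0//.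
  rewrite normrM -(real_normK (num_real (f x))) -(real_normK (num_real (h x))).
  have := sqr_ge0 (`|f x| - `|h x|).
  have := normr_ge0 (f x); have := normr_ge0 (h x); nra.
- by apply: integrableD => //; exact: sq.
Qed.

Lemma CL2_square_integrable (f : T -> R[i]) : CL2 m f ->
  square_integrable (fun x => complex.Re (f x)) /\
  square_integrable (fun x => complex.Im (f x)).
Proof.
move=> [/measurable_ReIm[mr mi] f2].
have mN : measurable_fun setT (fun x => (Normc.normc (f x) ^+ 2)%:E).
  rewrite (_ : (fun x => _) =
    (fun x => (complex.Re (f x) ^+ 2 + complex.Im (f x) ^+ 2)%:E)).
    apply/measurable_EFinP/measurable_funD; exact: measurable_funX.
  apply/funext => x; case: (f x) => a b /=.
  by rewrite sqr_sqrtr// addr_ge0// sqr_ge0.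
split; split => //; apply: le_lt_trans f2; apply: ge0_le_integral => //.
- by move=> x _; rewrite lee_fin sqr_ge0.
- by apply/measurable_EFinP; exact: measurable_funX.
- move=> x _; rewrite lee_fin; case: (f x) => a b /=.
  by rewrite sqr_sqrtr ?addr_ge0 ?sqr_ge0// lerDl sqr_ge0.
- by move=> x _; rewrite lee_fin sqr_ge0.
- by apply/measurable_EFinP; exact: measurable_funX.
- move=> x _; rewrite lee_fin; case: (f x) => a b /=.
  by rewrite sqr_sqrtr ?addr_ge0 ?sqr_ge0// lerDr sqr_ge0.
Qed.

Lemma CdotE (f h : T -> R[i]) : CL2 m f -> CL2 m h ->
  Cdot m f h =
  (\int[m]_x (complex.Re (f x) * complex.Re (h x)) +
   \int[m]_x (complex.Im (f x) * complex.Im (h x))) +i*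
  (\int[m]_x (complex.Im (f x) * complex.Re (h x)) -
   \int[m]_x (complex.Re (f x) * complex.Im (h x))).
Proof.
move=> /CL2_square_integrable[rf jf] /CL2_square_integrable[rh jh].
rewrite -RintegralD//; try exact: square_integrableM.
rewrite -RintegralB//; try exact: square_integrableM.
congr Complex; apply: eq_Rintegral => x _; case: (f x) => a b; case: (h x) => a' b' /=.
  by rewrite mulrN opprK.
by rewrite mulrN addrC.
Qed.

End Rintegral_facts.

(** * A real orthonormal basis of the module *)

Section indices.
Variables (l : nat) (odd_dim : bool).
Local Notation sc := (sc_indices l odd_dim).

Lemma mem_sc_indices (k : int) :
  (k \in sc) = (odd_dim || (k != 0)) && (`|k| <= l%:Z).
Proof.
rewrite mem_filter; congr (_ && _); apply/mapP/idP => [[i0]|kl].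
  rewrite mem_iota -addnn => /andP[_ il] ->; lia.
exists (absz (k + l%:Z)); last by lia.
by rewrite mem_iota -addnn; lia.
Qed.

Lemma sc_indices_uniq : uniq sc.
Proof.
by rewrite filter_uniq// map_inj_uniq ?iota_uniq// => i j; lia.
Qed.

Lemma sc_indicesN (k : int) : (- k \in sc) = (k \in sc).
Proof. by rewrite !mem_sc_indices normrN oppr_eq0. Qed.

(** The set of indices is symmetric. *)
Lemma sum_sc_indicesN (V : nmodType) (F : int -> V) :
  \sum_(k <- sc) F (- k) = \sum_(k <- sc) F k.
Proof.
rewrite -(big_map (fun k : int => - k) xpredT F); apply: perm_big.
have inj : injective (fun k : int => - k) by exact: oppr_inj.
apply: uniq_perm; rewrite ?(map_inj_uniq inj) ?sc_indices_uniq//.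
by move=> k; rewrite -[k in LHS]opprK (mem_map inj) sc_indicesN.
Qed.

End indices.

Section real_basis_theory.
Local Open Scope quotient_scope.
Variables (R : realType) (G : topologicalGroupType) (K : closedSubgroup G).
Local Notation X := (coset_space K).
Variables (mu : probability X R) (V : set (X -> R[i])).
Hypothesis V_irr : irreducible_Gmodule mu V.
Variables (l : nat) (odd_dim : bool) (v : int -> X -> R[i]).
Hypothesis v_basis : self_conjugated_orthonormal_basis mu V l odd_dim v.
Local Notation sc := (sc_indices l odd_dim).

(** The factor that gives norm [1] to the real and imaginary parts of [v k],
    each of which carries half of the norm of [v k] when [k != 0]. *)
Definition basis_scale (k : int) : R := if k == 0 then 1 else Num.sqrt 2.

(** Keeping the index set of [v]: since [v (- k)] is the conjugate of [v k], the
    real parts are indexed by the nonnegative [k] and the imaginary parts by the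
    negative ones. *)
Definition real_basis (k : int) (x : X) : R :=
  basis_scale k * (if k < 0 then complex.Im (v k x) else complex.Re (v k x)).
Local Notation u := real_basis.

(** The coordinates in [real_basis] of the real function with coordinates [a] in
    [v], see [sum_real_coef].  The index [- k] makes the imaginary part one of
    those of the coefficients of nonnegative index. *)
Definition real_coef (a : int -> R[i]) (k : int) : R :=
  basis_scale k * (if k < 0 then complex.Im (a (- k)) else complex.Re (a k)).

Lemma sqr_basis_scale k : k != 0 -> basis_scale k * basis_scale k = 2.
Proof. by move=> /negbTE k0; rewrite /basis_scale k0 -expr2 sqr_sqrtr. Qed.

Lemma basis_scaleN k : basis_scale (- k) = basis_scale k.
Proof. by rewrite /basis_scale oppr_eq0. Qed.

Lemma basis_CL2 k : k \in sc -> CL2 mu (v k).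
Proof. by case: v_basis => Vv _ _ _ ksc; case: V_irr => VL2 _ _ _ _; exact/VL2/Vv. Qed.

Lemma v_opp k x : k \in sc -> v (- k) x = (v k x)^*.
Proof. by case: v_basis => _ _ _ vN ksc; exact: vN. Qed.

Lemma Re_v_opp k x : k \in sc -> complex.Re (v (- k) x) = complex.Re (v k x).
Proof. by move=> ksc; rewrite v_opp//; case: (v k x). Qed.

Lemma Im_v_opp k x : k \in sc -> complex.Im (v (- k) x) = - complex.Im (v k x).
Proof. by move=> ksc; rewrite v_opp//; case: (v k x). Qed.

(** The sum and the difference of the orthonormality relations of [v j] with
    [v k] and with [v (- k)], the conjugate of [v k]. *)
Lemma real_inner_products j k : j \in sc -> k \in sc ->
  [/\ \int[mu]_x (complex.Re (v j x) * complex.Re (v k x)) =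
        ((j == k)%:R + (j == - k)%:R) / 2,
      \int[mu]_x (complex.Im (v j x) * complex.Im (v k x)) =
        ((j == k)%:R - (j == - k)%:R) / 2 &
      \int[mu]_x (complex.Im (v j x) * complex.Re (v k x)) = 0].
Proof.
move=> jsc ksc; have nksc : - k \in sc by rewrite sc_indicesN.
case: v_basis => _ on _ _.
have := on _ _ jsc nksc; have := on _ _ jsc ksc.
rewrite !CdotE; try exact: basis_CL2.
under [X in _ -> (X + _) +i* _ = _ -> _]eq_Rintegral do rewrite Re_v_opp//.
under [X in _ -> (_ + X) +i* _ = _ -> _]eq_Rintegral do rewrite Im_v_opp// mulrN.
under [X in _ -> _ +i* (X - _) = _ -> _]eq_Rintegral do rewrite Re_v_opp//.
under [X in _ -> _ +i* (_ - X) = _ -> _]eq_Rintegral do rewrite Im_v_opp// mulrN.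
rewrite !Rintegral_opp opprK.
have reE (b : bool) : b%:R = (b%:R : R) +i* 0 by case: b.
by rewrite !reE => -[e1 e2] [e3 e4]; split; lra.
Qed.

Lemma real_basis_orthonormal j k : j \in sc -> k \in sc ->
  \int[mu]_x (u j x * u k x) = (j == k)%:R.
Proof.
move=> jsc ksc.
have [rr ii ir] := real_inner_products jsc ksc.
have [_ _ ri] := real_inner_products ksc jsc.
have [rj ij] := CL2_square_integrable (basis_CL2 jsc).
have [rk ik] := CL2_square_integrable (basis_CL2 ksc).
pose w k x := if k < 0 then complex.Im (v k x) else complex.Re (v k x).
have wi : mu.-integrable setT (EFin \o (fun x => w j x * w k x)).
  by rewrite /w; case: (j < 0); case: (k < 0); exact: square_integrableM.
transitivity (basis_scale j * basis_scale k * \int[mu]_x (w j x * w k x)).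
  by rewrite -RintegralZl//; apply: eq_Rintegral => x _; rewrite mulrACA.
rewrite /w; have [j0|j0] := ltP j 0; have [k0|k0] := ltP k 0.
- rewrite ii; have -> : (j == - k) = false by lia.
  have [<-|_] := eqVneq j k; last by rewrite subr0 mul0r mulr0.
  by rewrite sqr_basis_scale; [rewrite mulr1n mulr0n; lra|lia].
- by rewrite ir mulr0; have -> : (j == k) = false by lia.
- under eq_Rintegral do rewrite mulrC.
  by rewrite ri mulr0; have -> : (j == k) = false by lia.
- rewrite rr; have [->|kN0] := eqVneq k 0.
    rewrite oppr0; have [->|_] := eqVneq j 0; last by rewrite addr0 mul0r mulr0.
    by rewrite /basis_scale eqxx mulr1n; lra.
  have -> : (j == - k) = false by lia.
  have [->|_] := eqVneq j k; last by rewrite addr0 mul0r mulr0.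
  by rewrite sqr_basis_scale// mulr1n mulr0n; lra.
Qed.

(** The terms of index [k] and [- k] are grouped together; each group is the
    same on both sides. *)
Lemma sum_real_coef (a : int -> R[i]) x :
  {in sc, forall k, a (- k) = (a k)^*} ->
  \sum_(k <- sc) a k * v k x = (\sum_(k <- sc) real_coef a k * u k x)%:C.
Proof.
move=> aN.
pose c k : R := complex.Re (a k) * complex.Re (v k x)
                - complex.Im (a k) * complex.Im (v k x).
(* summing twice pairs every index with its opposite, without splitting the
   sum according to the sign of the index *)
have symm (W : zmodType) (F H : int -> W) :
    {in sc, forall k, F k + F (- k) = H k + H (- k)} ->
    (\sum_(k <- sc) F k) *+ 2 = (\sum_(k <- sc) H k) *+ 2.
  move=> FH; rewrite !mulr2n -{2}(sum_sc_indicesN _ _ F) -{2}(sum_sc_indicesN _ _ H).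
  by rewrite -!big_split; apply: eq_big_seq => k /FH.
have inj2 (y z : R[i]) : y *+ 2 = z *+ 2 -> y = z.
  by move/eqP; rewrite eqrMn2r//= => /eqP.
transitivity (\sum_(k <- sc) (c k)%:C).
  apply: inj2; apply: symm => k ksc; rewrite /c v_opp// aN//.
  case: (a k) => a1 a2; case: (v k x) => v1 v2 /=.
  by congr Complex => /=; ring.
rewrite [RHS]rmorph_sum /=; apply: inj2; apply: symm => k ksc.
rewrite -!rmorphD /=; congr (_%:C); rewrite /c /real_coef /u !basis_scaleN opprK.
have sqrE (m y z : R) : m * y * (m * z) = m * m * (y * z) by ring.
rewrite !sqrE.
have [k0|k0|k0] := ltgtP k 0.
- have -> : (- k < 0) = false by lia.
  rewrite sqr_basis_scale; last by lia.
  rewrite v_opp// aN//.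
  by case: (a k) => a1 a2; case: (v k x) => v1 v2 /=; ring.
- have -> : (- k < 0) by lia.
  rewrite sqr_basis_scale; last by lia.
  rewrite v_opp// aN//.
  by case: (a k) => a1 a2; case: (v k x) => v1 v2 /=; ring.
- (* [a 0] and [v 0 x] are their own conjugates, hence real *)
  rewrite k0 oppr0 ltxx /basis_scale eqxx.
  have := aN _ ksc; have := v_opp x ksc; rewrite k0 oppr0.
  case: (a 0) => a1 a2; case: (v 0 x) => v1 v2 /= [v20] [a20].
  have -> : a2 = 0 by lra.
  by ring.
Qed.

Lemma V_lin (c c' : R[i]) f h : V f -> V h -> V (fun x => c * f x + c' * h x).
Proof.
case: V_irr => _ _ [V0 VD _] _ _ Vf Vh; apply: (VD) => //.
rewrite (_ : (fun x => _) = fun x => c' * h x + 0); first exact: VD.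
by apply/funext => x; rewrite addr0.
Qed.

Lemma real_basis_V k : k \in sc -> V (fun x => (u k x)%:C).
Proof.
move=> ksc; have [Vv _ _ _] := v_basis.
have nksc : - k \in sc by rewrite sc_indicesN.
have VD c c' := @V_lin c c' _ _ (Vv _ ksc) (Vv _ nksc).
have [k0|k0] := ltP k 0.
  rewrite (_ : (fun x => _) = fun x => (0 -i* (basis_scale k / 2)) * v k x +
    (0 +i* (basis_scale k / 2)) * v (- k) x); first exact: VD.
  apply/funext => x; rewrite v_opp// /u k0.
  by case: (v k x) => v1 v2 /=; congr Complex => /=; field.
rewrite (_ : (fun x => _) = fun x => (basis_scale k / 2)%:C * v k x +
  (basis_scale k / 2)%:C * v (- k) x); first exact: VD.
apply/funext => x; rewrite v_opp// /u ltNge k0 /=.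
by case: (v k x) => v1 v2 /=; congr Complex => /=; field.
Qed.

(** Conjugating an expansion of [f] in [v] gives another one; the mean of the
    two has conjugate-symmetric coefficients, and [sum_real_coef] applies. *)
Lemma real_basis_expand (f : X -> R) : V (fun x => (f x)%:C) ->
  exists c : int -> R, forall x, f x = \sum_(k <- sc) c k * u k x.
Proof.
move=> Vf; have [_ _ span _] := v_basis; have [c0 fE] := span _ Vf.
pose half : R[i] := (2^-1)%:C.
pose a k := half * (c0 k + (c0 (- k))^* ).
have aN : {in sc, forall k, a (- k) = (a k)^*}.
  move=> k _; rewrite /a opprK /half; case: (c0 k) => x y; case: (c0 (- k)) => z t /=.
  by congr Complex => /=; ring.
exists (real_coef a) => x; apply: (@complexI R) => /=.
rewrite -(sum_real_coef x aN).
have fE' : (f x)%:C = \sum_(k <- sc) (c0 (- k))^* * v k x.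
  transitivity ((f x)%:C^*); first by congr Complex; rewrite oppr0.
  rewrite fE rmorph_sum /= -(sum_sc_indicesN _ _ (fun k => (c0 (- k))^* * v k x)).
  by apply: eq_big_seq => k ksc; rewrite opprK v_opp// rmorphM.
transitivity (half * ((f x)%:C + (f x)%:C)).
  by rewrite /half; congr Complex => /=; field.
rewrite {1}fE fE' -big_split mulr_sumr; apply: eq_bigr => k _ /=.
by rewrite -mulrDl mulrA.
Qed.

Hypothesis mu_dx : normalized_invariant_measure mu.

(** The action lifts to the left translation of [G] by [g]. *)
Lemma continuous_coset_act g : continuous (coset_act g : X -> X).
Proof.
apply/quotient_continuous.
rewrite (_ : _ \o _ = \pi_X \o (fun h => g * h)%g); last first.
  by apply/funext => h /=; rewrite coset_act_pi.
move=> h; apply: continuous_comp; last exact: pi_continuous.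
apply: (@continuous_comp _ _ _ (fun h => (g, h)) (fun p => p.1 * p.2)%g).
  by apply: cvg_pair; [exact: cvg_cst|exact: cvg_id].
exact: mulg_continuous.
Qed.

Lemma measurable_coset_act g : measurable_fun setT (coset_act g : X -> X).
Proof.
apply: (measurability (@open X)) => //.
move=> _ [U oU <-]; rewrite setTI; apply: sub_sigma_algebra.
by have /continuousP := @continuous_coset_act g; exact.
Qed.

Lemma Rintegral_coset_act g (f : X -> R) :
  mu.-integrable setT (EFin \o f) ->
  mu.-integrable setT (EFin \o (f \o coset_act g)) /\
  \int[mu]_x f (coset_act g x) = \int[mu]_x f x.
Proof.
have mg := @measurable_coset_act g; have [inv _] := mu_dx.
have muE A : measurable A -> A `<=` setT -> image_measure mu mg A = mu A.
  by move=> mA _; exact: inv.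
move=> fi; have /integrableP[mf f_fin] := fi.
have fgi : mu.-integrable setT (EFin \o (f \o coset_act g)).
  apply/integrableP; split; first exact: (measurableT_comp mf mg).
  rewrite -(ge0_integral_image (h := fun x => `|(f x)%:E|%E) mu mg measurableT)//.
    by rewrite (eq_measure_integral mu muE).
  exact: measurableT_comp.
split => //; rewrite /Rintegral; congr fine.
transitivity (\int[image_measure mu mg]_x (f x)%:E)%E.
  exact/esym/(integral_pushforward mg mf fgi measurableT).
exact: eq_measure_integral.
Qed.

(** The translates of the [u p] lie in [V] and are real, hence the matrix; its
    columns are orthonormal because the [u p] and their translates are. *)
Lemma real_basis_translate g : exists O : int -> int -> R,
  (forall p, p \in sc -> forall x,
     u p (coset_act g x) = \sum_(q <- sc) O q p * u q x) /\
  {in sc &, forall p p', \sum_(q <- sc) O q p * O q p' = (p == p')%:R}.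
Proof.
have /choice[c cE] : forall p, exists c : int -> R, p \in sc -> forall x,
    u p (coset_act g x) = \sum_(q <- sc) c q * u q x.
  move=> p; have [psc|//] := boolP (p \in sc); last by exists (fun=> 0).
  have [_ _ [_ _ Vtr] _ _] := V_irr.
  have := Vtr g^-1%g _ (real_basis_V psc).
  rewrite /left_translate invgK => /real_basis_expand[c cE].
  by exists c.
exists (fun q p => c p q); split=> // p p' psc p'sc.
rewrite -(real_basis_orthonormal psc p'sc).
have u2 k : k \in sc -> square_integrable mu (u k).
  move=> ksc; have [rk ik] := CL2_square_integrable (basis_CL2 ksc).
  by apply: square_integrableZ; case: (k < 0).
have iu j k : j \in sc -> k \in sc ->
    mu.-integrable setT (EFin \o (fun x => u j x * u k x)).
  by move=> /u2 ? /u2 ?; exact: square_integrableM.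
have [_ <-] := Rintegral_coset_act g (iu _ _ psc p'sc).
(* the terms of the bilinear expansion of the product of the two translates *)
have F q q' : q \in sc -> q' \in sc -> mu.-integrable setT
    (EFin \o (fun x => c p q * c p' q' * (u q x * u q' x))).
  move=> qsc q'sc; rewrite (_ : _ \o _ =
    (fun x => (c p q * c p' q')%:E * (u q x * u q' x)%:E))%E//.
  by apply: integrableZl => //; exact: iu.
transitivity (\int[mu]_x \sum_(q <- sc) \sum_(q' <- sc)
  (c p q * c p' q' * (u q x * u q' x))); last first.
  apply: eq_Rintegral => x _; rewrite !cE// mulr_suml; apply: eq_bigr => q _.
  by rewrite mulr_sumr; apply: eq_bigr => q' _; rewrite mulrACA.
rewrite Rintegral_sum; last by move=> q qsc; apply: integrable_sumR => q' q'sc; exact: F.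
apply: eq_big_seq => q qsc; rewrite Rintegral_sum; last by move=> q' q'sc; exact: F.
rewrite (bigD1_seq q)//= ?sc_indices_uniq// big_seq_cond big1 ?addr0.
  by rewrite RintegralZl// ?iu// real_basis_orthonormal// eqxx mulr1.
move=> q' /andP[q'sc q'q]; rewrite RintegralZl// ?iu// real_basis_orthonormal//.
by rewrite eq_sym (negbTE q'q) mulr0.
Qed.

End real_basis_theory.

(** * The random field in the real basis *)

Lemma independent_family (R : realType) d (Omega : measurableType d)
    (P : probability Omega R) (J : eqType) (D : seq J) (Y : J -> Omega -> R)
    (n : nat) (phi : 'I_n -> J) (A : 'I_n -> set R) :
  mutually_independent P D Y -> injective phi -> (forall i, phi i \in D) ->
  (forall i, measurable (A i)) ->
  P [set w | forall i, A i (Y (phi i) w)] = (\prod_i P (Y (phi i) @^-1` A i))%E.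
Proof.
move=> indep phiI phiD mA.
pose A' j := if [pick i | phi i == j] is Some i0 then A i0 else setT.
have A'E i0 : A' (phi i0) = A i0.
  rewrite /A'; case: pickP => [j /eqP/phiI->//|/(_ i0)].
  by rewrite eqxx.
have mA' j : measurable (A' j) by rewrite /A'; case: pickP.
have := indep [seq phi i0 | i0 <- index_enum 'I_n].
rewrite map_inj_uniq ?index_enum_uniq// => /(_ isT) /(_ _ A' mA').
have sub : {subset [seq phi i0 | i0 <- index_enum 'I_n] <= D}.
  by move=> _ /mapP[i0 _ ->].
move=> /(_ sub); rewrite !big_map => PE.
rewrite (eq_bigr (fun i0 => P (Y (phi i0) @^-1` A' (phi i0)))); last first.
  by move=> i0 _; rewrite A'E.
rewrite -PE; congr (P _).
rewrite (eq_bigr (fun i0 => Y (phi i0) @^-1` A i0)); last first.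
  by move=> i0 _; rewrite A'E.
apply/seteqP; split => w /=; rewrite -bigcap_seq.
  by move=> Aw i0 _; exact: Aw.
by move=> Aw i0; apply: Aw; rewrite /= mem_index_enum.
Qed.

Section translated_field.
Variables (R : realType) (G : topologicalGroupType) (K : closedSubgroup G).
Local Notation X := (coset_space K).
Local Notation RR := (measurableTypeR R).
Variables (mu : probability X R) (mu_dx : normalized_invariant_measure mu).
Variables (V : set (X -> R[i])) (V_irr : irreducible_Gmodule mu V).
Variables (l : nat) (odd_dim : bool) (v : int -> X -> R[i]).
Hypothesis v_basis : self_conjugated_orthonormal_basis mu V l odd_dim v.
Local Notation sc := (sc_indices l odd_dim).
Context (dO : measure_display) (Omega : measurableType dO)
  (P : probability Omega R).
Variable a : int -> Omega -> R[i].
Hypothesis a_conj : {in sc, forall k w, a (- k) w = (a k w)^*}.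
Hypothesis a_gaussian : {in nonneg_re_im_indices l odd_dim, forall p,
  gaussian P (re_im a p)}.
Hypothesis a_centered : {in nonneg_re_im_indices l odd_dim, forall p,
  centered P (re_im a p)}.
Hypothesis a_indep :
  mutually_independent P (nonneg_re_im_indices l odd_dim) (re_im a).
Variable c : R.
Hypothesis a_var : {in sc, forall k, k != 0 ->
  ('E_P[fun w => (complex.Re (a k w) ^+ 2)%R] = (c / 2)%:E)%E /\
  ('E_P[fun w => (complex.Im (a k w) ^+ 2)%R] = (c / 2)%:E)%E}.
Hypothesis a0_var : odd_dim ->
  ('E_P[fun w => (complex.Re (a 0 w) ^+ 2)%R] = c%:E)%E.

Let n := size sc.
Let idx (i : 'I_n) : int := nth 0 sc i.
Let u := real_basis v.

Let idx_sc i : idx i \in sc. Proof. exact: mem_nth. Qed.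

Let idx_inj : injective idx.
Proof.
by move=> i j /eqP; rewrite nth_uniq ?sc_indices_uniq// => /eqP/val_inj.
Qed.

Let sum_idx (W : nmodType) (F : int -> W) :
  \sum_(k <- sc) F k = \sum_i F (idx i).
Proof. by rewrite (big_nth 0) big_mkord. Qed.

(** The real variable among those of nonnegative index that gives the coefficient
    of index [k]. *)
Let phi (k : int) : int * bool := (`|k|, k < 0).

Let phi_inj : injective phi.
Proof. by move=> j k []; lia. Qed.

Let phi_idx i : phi (idx i) \in nonneg_re_im_indices l odd_dim.
Proof.
apply/allpairsP; exists (phi (idx i)); split => //=.
  rewrite mem_filter normr_ge0 /= mem_sc_indices normr_id normr_eq0.
  by have := idx_sc i; rewrite mem_sc_indices.
by case: (_ < _).
Qed.

Let xi (i : 'I_n) (w : Omega) : RR := real_coef (a ^~ w) (idx i).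

Let xiE i : xi i = scaling (basis_scale R (idx i)) \o re_im a (phi (idx i)).
Proof.
apply/funext => w; rewrite /xi /real_coef /scaling /re_im /phi /=.
by case: ltP => k0; [rewrite ltr0_norm|rewrite ger0_norm].
Qed.

(** The scale of the normal law of variance [c], see [normal_scale_of_moment2]. *)
Let sigma := Num.sqrt (c / fine (@normal_moment2 R)).

(** The variances [c / 2] for [k != 0] and [c] for [k = 0] are made equal by
    [basis_scale]. *)
Lemma coef_law i (A : set RR) : measurable A ->
  P (xi i @^-1` A) = centered_normal sigma A.
Proof.
move=> mA; have p_in := phi_idx i.
have msA (t : R) : measurable (scaling t @^-1` A).
  by rewrite -[X in measurable X]setTI; exact: measurable_scaling.
rewrite xiE comp_preimage; set k := idx i.
have absk_sc : `|k| \in sc.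
  have := idx_sc i; rewrite -/k.
  by rewrite !mem_sc_indices normr_id normr_eq0.
have [v0 [Ev0 v0E]] : exists v0,
    ('E_P[fun w => (re_im a (phi k) w ^+ 2)%R] = v0%:E)%E /\
    basis_scale R k ^+ 2 * v0 = c.
  have [k0|k0] := eqVneq k 0.
    exists c; rewrite /basis_scale k0 eqxx expr1n mul1r; split=> //.
    by apply: a0_var; have := idx_sc i; rewrite -/k k0 mem_sc_indices eqxx orbF => /andP[].
  exists (c / 2); rewrite expr2 sqr_basis_scale//; split; last by field.
  have [|re im] := a_var absk_sc; first by rewrite normr_eq0.
  by rewrite /re_im /phi /=; case: (k < 0).
have [s [s0 sM ->//]] :=
  centered_gaussian_law (a_gaussian p_in) (a_centered p_in) Ev0.
have sE : basis_scale R k * s = sigma.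
  apply: normal_scale_of_moment2.
    by rewrite mulr_ge0// /basis_scale; case: ifP => // _; rewrite sqrtr_ge0.
  by rewrite exprMn EFinM -muleA sM -EFinM v0E.
rewrite !centered_normalE -sE; congr (normal_prob 0 1 _).
by apply/seteqP; split => x; rewrite /scaling /= mulrA.
Qed.

Let measurable_xi i : measurable_fun setT (xi i).
Proof.
rewrite xiE; apply: measurableT_comp; first exact: measurable_scaling.
by case: (a_gaussian (phi_idx i)).
Qed.

Lemma iid_coef : iid P (centered_normal sigma) xi.
Proof.
split=> // A mA.
transitivity (\prod_i P (xi i @^-1` A i))%E; last first.
  by apply: eq_bigr => i _; exact: coef_law.
have msA i : measurable (scaling (basis_scale R (idx i)) @^-1` A i).
  by rewrite -[X in measurable X]setTI; exact: measurable_scaling.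
have inj : injective (phi \o idx) by exact: inj_comp.
rewrite -[RHS](_ : (\prod_i P (re_im a (phi (idx i)) @^-1`
    (scaling (basis_scale R (idx i)) @^-1` A i)) = _)%E); last first.
  by apply: eq_bigr => i _; rewrite xiE.
rewrite -(independent_family a_indep inj phi_idx msA).
by congr (P _); apply/seteqP; split => w /= Aw i; have := Aw i; rewrite xiE.
Qed.

Let T_V (x : X) (w : Omega) : R[i] := \sum_(k <- sc) a k w * v k x.

Let T_VE x w : T_V x w = (\sum_i xi i w * u (idx i) x)%:C.
Proof.
rewrite /T_V (sum_real_coef v_basis x (a := a ^~ w)) ?sum_idx//.
by move=> k ksc; exact: a_conj.
Qed.

Let measurable_u k : k \in sc -> measurable_fun setT (u k).
Proof.
move=> ksc; have [[mr _] [mi _]] := CL2_square_integrable (basis_CL2 V_irr v_basis ksc).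
by rewrite /u /real_basis; case: (k < 0); exact: measurable_funM.
Qed.

Lemma random_field_T_V : random_field T_V.
Proof.
rewrite /random_field.
rewrite (_ : (fun p => _) = fun p : X * Omega =>
  (\sum_i xi i p.2 * u (idx i) p.1)%:C); last by apply/funext => p; exact: T_VE.
apply/measurable_ReIm; split => //=.
apply: measurable_sum => i; apply: measurable_funM.
  exact: (measurableT_comp (measurable_xi i) measurable_snd).
exact: (measurableT_comp (measurable_u (idx_sc i)) measurable_fst).
Qed.

(** The values of the field and of its translate at given points are the images
    under one map [Phi] of the vectors [xi] and [M' xi], which have the same
    law. *)
Lemma G_invariant_T_V : G_invariant P T_V.
Proof.
move=> g m x B mB.
have [M [uM orth]] := real_basis_translate V_irr v_basis mu_dx g.
pose M' (i j : 'I_n) := M (idx i) (idx j).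
have orth' : orthonormal_cols M'.
  move=> p q; rewrite /M' -(sum_idx (fun k => M k (idx p) * M k (idx q))).
  by rewrite orth// (inj_eq idx_inj).
pose Phi (t : n.-tuple RR) : m.-tuple R[i] :=
  [tuple (\sum_i tnth t i * u (idx i) (tnth x j))%:C | j < m].
have mPhi : measurable_fun setT Phi.
  apply/measurable_fun_tnthP => j.
  rewrite (_ : _ \o _ = fun t : n.-tuple RR =>
      (\sum_i tnth t i * u (idx i) (tnth x j))%:C); last first.
    by apply/funext => t /=; rewrite tnth_mktuple.
  apply/measurable_ReIm; split => //=; apply: measurable_sum => i.
  by apply: measurable_funM => //; exact: measurable_tnth.
have mPB : measurable (Phi @^-1` B) by rewrite -[X in measurable X]setTI; exact: mPhi.
have rot := @centered_normal_rotation R sigma.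
have E1 : (fun w => [tuple T_V (tnth x j) w | j < m]) =
    Phi \o (fun w => [tuple xi i w | i < n]).
  apply/funext => w; apply: eq_mktuple => j; rewrite T_VE; congr (_%:C).
  by apply: eq_bigr => i _; rewrite tnth_mktuple.
have E2 : (fun w => [tuple T_V (coset_act g (tnth x j)) w | j < m]) =
    Phi \o (fun w => [tuple linear_mix M' xi i w | i < n]).
  apply/funext => w; apply: eq_mktuple => j; rewrite T_VE; congr (_%:C).
  transitivity (\sum_i \sum_p M' i p * xi p w * u (idx i) (tnth x j)).
    rewrite exchange_big /=; apply: eq_bigr => p _.
    rewrite /u uM// sum_idx mulr_sumr; apply: eq_bigr => i _.
    by rewrite /M' /u; ring.
  by apply: eq_bigr => i _; rewrite tnth_mktuple /linear_mix mulr_suml.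
rewrite E1 E2.
exact: (iid_tuple_law iid_coef (iid_orthogonal rot orth' iid_coef) mPB).
Qed.

End translated_field.

Theorem theorem4p7 (R : realType) (G : topologicalGroupType)
    (G_compact : compact [set: G]) (G_hausdorff : hausdorff_space G)
    (K : closedSubgroup G)
    (mu : probability (coset_space K) R)
    (mu_dx : normalized_invariant_measure mu)
    (V : set (coset_space K -> R[i]))
    (V_irr : irreducible_Gmodule mu V) (V_sc : self_conjugated V)
    (l : nat) (odd_dim : bool) (v : int -> coset_space K -> R[i])
    (v_basis : self_conjugated_orthonormal_basis mu V l odd_dim v)
    (dO : measure_display) (Omega : measurableType dO)
    (P : probability Omega R)
    (T : coset_space K -> Omega -> R)
    (T_field : random_field T) (T_L2 : as_square_integrable P mu T)
    (a : int -> Omega -> R[i]) (a_coef : a = random_coef mu T v)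
    (a_gaussian : {in nonneg_re_im_indices l odd_dim, forall p,
       gaussian P (re_im a p)})
    (a_centered : {in nonneg_re_im_indices l odd_dim, forall p,
       centered P (re_im a p)})
    (a_indep : mutually_independent P (nonneg_re_im_indices l odd_dim)
       (re_im a))
    (c : R) (c_ge0 : 0 <= c)
    (a_var : {in sc_indices l odd_dim, forall k, k != 0 ->
       ('E_P[fun w => (complex.Re (a k w) ^+ 2)%R] = (c / 2)%:E)%E /\
       ('E_P[fun w => (complex.Im (a k w) ^+ 2)%R] = (c / 2)%:E)%E})
    (a0_var : odd_dim ->
       ('E_P[fun w => (complex.Re (a 0 w) ^+ 2)%R] = c%:E)%E) :
  let T_V : coset_space K -> Omega -> R[i] :=
    fun x w => \sum_(k <- sc_indices l odd_dim) a k w * v k x in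
  random_field T_V /\ G_invariant P T_V.
Proof.
(* [T] is real *)
have a_conj : {in sc_indices l odd_dim, forall k w, a (- k) w = (a k w)^*}.
  move=> k ksc w; have [_ _ _ vN] := v_basis.
  rewrite a_coef; congr Complex; last rewrite -Rintegral_opp;
    apply: eq_Rintegral => x _; rewrite (vN _ ksc);
    by case: (v k x) => v1 v2 /=; ring.
split.
  exact: (random_field_T_V V_irr v_basis a_conj a_gaussian).
exact: (G_invariant_T_V mu_dx V_irr v_basis a_conj a_gaussian a_centered
  a_indep a_var a0_var).
Qed.
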